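(* Let $n \geq 3$ and $1 \leq k < n$, and let $A \in \mathbb{R}^{n \times n}$. Then the following statements hold: (a) If $A \in \mathbf{E_{0_k}}$ (resp., $A \in \mathbf{E_k}$), then all diagonal entries of $A$ are nonnegative (resp., positive). (b) If $A \in \mathbf{E_{0_k}}$ (resp., $A \in \mathbf{E_k}$) and $n = k+1$, then all off-diagonal entries of $A$ are negative; that is, $A$ is a $\mathbf{Z}$-matrix.
   Context: All matrices are real. A matrix $M \in \mathbb{R}^{m\times m}$ is semimonotone if for every $0 \neq x \geq 0$ (entrywise) there is an index $i$ with $x_i > 0$ and $(Mx)_i \geq 0$; it is strictly semimonotone if for every $0 \neq x \geq 0$ there is an index $i$ with $x_i>0$ and $(Mx)_i > 0$. For $0 \le k \le n$, $\mathbf{E_{0_k}}$ denotes the class of matrices $A \in \mathbb{R}^{n\times n}$ (semimonotone of exact order $k$) such that every principal submatrix of $A$ of order $n-k$ is semimonotone, but no principal submatrix of $A$ of order $r$ with $n-k < r \leq n$ is semimonotone. $\mathbf{E_k}$ (strictly semimonotone of exact order $k$) is defined the same way with ''strictly semimonotone'' in place of ''semimonotone''. A $\mathbf{Z}$-matrix is a real square matrix whose off-diagonal entries are all nonpositive. *)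

(* Defs.v *)
From HB Require Import structures.
From mathcomp Require Import all_boot all_order all_algebra.
From mathcomp Require Import reals.

Set Implicit Arguments.
Unset Strict Implicit.
Unset Printing Implicit Defensive.

Import Order.TTheory GRing.Theory Num.Theory.
Local Open Scope ring_scope.

Definition semimonotone (R : realType) (m : nat) (M : 'M[R]_m) : Prop :=
  forall x : 'cV[R]_m, x != 0 -> (forall j, 0 <= x j 0) ->
    exists i : 'I_m, 0 < x i 0 /\ 0 <= (M *m x) i 0.

Definition strictly_semimonotone (R : realType) (m : nat) (M : 'M[R]_m)
    : Prop :=
  forall x : 'cV[R]_m, x != 0 -> (forall j, 0 <= x j 0) ->
    exists i : 'I_m, 0 < x i 0 /\ 0 < (M *m x) i 0.

(* Rows and columns indexed by S, in increasing order; its order is #|S|. *)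
Definition principal_submx (R : realType) (n : nat) (A : 'M[R]_n)
    (S : {set 'I_n}) : 'M[R]_#|S| :=
  mxsub (@enum_val _ (mem S)) (@enum_val _ (mem S)) A.

(* Meaningful for k <= n: the subtraction n - k is truncated. *)
Definition of_exact_order (R : realType) (P : forall m : nat, 'M[R]_m -> Prop)
    (n k : nat) (A : 'M[R]_n) : Prop :=
  (forall S : {set 'I_n}, #|S| = (n - k)%N -> P #|S| (principal_submx A S)) /\
  (forall r : nat, (n - k < r <= n)%N ->
     forall S : {set 'I_n}, #|S| = r -> ~ P #|S| (principal_submx A S)).

Definition E0_class (R : realType) (n k : nat) (A : 'M[R]_n) : Prop :=
  of_exact_order (@semimonotone R) k A.

Definition E_class (R : realType) (n k : nat) (A : 'M[R]_n) : Prop :=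
  of_exact_order (@strictly_semimonotone R) k A.

Definition Z_matrix (R : realType) (n : nat) (A : 'M[R]_n) : Prop :=
  forall i j : 'I_n, i != j -> A i j <= 0.

(* Main.v *)
Require Import Defs.
From HB Require Import structures.
From mathcomp Require Import all_boot all_order all_algebra.
From mathcomp Require Import reals.

Set Implicit Arguments.
Unset Strict Implicit.
Unset Printing Implicit Defensive.

Import Order.TTheory GRing.Theory Num.Theory.
Local Open Scope ring_scope.

(* A standard basis vector tests a single diagonal entry, which gives (a). In (b)
   the exact order forbids order-2 principal submatrices that are semimonotone;
   but if [A i j >= 0] and the diagonal has the right sign, the submatrix on
   [{i, j}] is semimonotone, with witness [i] when [x_i > 0] and [j] otherwise. *)

(* [b = true] is [semimonotone] and [b = false] is [strictly_semimonotone],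
   both up to conversion. *)
Definition semimonotone_if (b : bool) (R : realType) (m : nat) (M : 'M[R]_m)
    : Prop :=
  forall x : 'cV[R]_m, x != 0 -> (forall j, 0 <= x j 0) ->
    exists i : 'I_m, 0 < x i 0 /\ 0 < (M *m x) i 0 ?<= if b.

(** Trades vectors indexed by ['I_#|S|] for functions on all of ['I_n], so that later arguments
    avoid [enum_val]. The sums run over [S] only, so values of [y] off [S] are harmless; for a
    nonnegative vector, being nonzero means having a positive entry. *)
Lemma semimonotone_if_principal (b : bool) (R : realType) (n : nat)
    (A : 'M[R]_n) (S : {set 'I_n}) :
  semimonotone_if b (principal_submx A S) <->
  (forall y : 'I_n -> R, (forall j, 0 <= y j) ->
    (exists2 j, j \in S & 0 < y j) ->
    exists2 i, i \in S &
      0 < y i /\ 0 < \sum_(j in S) A i j * y j ?<= if b).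
Proof.
split=> [semiA y y_ge0 [j jS yj_gt0] | semiA x x_neq0 x_ge0].
  have [||a [ya_gt0 Aya]] := semiA (\col_a y (enum_val a)).
  - apply: contraTneq yj_gt0 => /colP/(_ (enum_rank_in jS j)).
    by rewrite !mxE enum_rankK_in // => ->; rewrite ltxx.
  - by move=> a; rewrite mxE.
  exists (enum_val a); first exact: enum_valP.
  split; first by rewrite mxE in ya_gt0.
  move: Aya; rewrite mxE [X in _ -> _ < X ?<= if _]big_enum_val /=.
  by under eq_bigr do rewrite !mxE.
(* Extension of [x] by zero: the sum is empty off [S] and has a single term on [S], since [enum_val]
   is injective. No proof of [j \in S] is needed to write it. *)
pose y j := \sum_(a | enum_val a == j) x a 0.
have yE a : y (enum_val a) = x a 0.
  by rewrite /y (big_pred1 a) // => c; rewrite /= (inj_eq enum_val_inj).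
have [|| i iS [yi_gt0 Ayi]] := semiA y.
- by move=> j; apply: sumr_ge0 => a _.
- have /cV0Pn[a xa_neq0] := x_neq0.
  by exists (enum_val a); [exact: enum_valP | rewrite yE lt_def xa_neq0 x_ge0].
exists (enum_rank_in iS i).
rewrite -yE enum_rankK_in //; split=> //.
move: Ayi; rewrite mxE big_enum_val /=.
under eq_bigr do rewrite yE.
by under [X in _ -> _ < X ?<= if _]eq_bigr do rewrite mxE enum_rankK_in //.
Qed.

Lemma semimonotone_if_diag (b : bool) (R : realType) (n : nat) (A : 'M[R]_n)
    (S : {set 'I_n}) (i : 'I_n) :
  semimonotone_if b (principal_submx A S) -> i \in S ->
  0 < A i i ?<= if b.
Proof.
move=> /semimonotone_if_principal semiA iS.
have [||j _] := semiA (fun j => (j == i)%:R).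
- by move=> j; exact: ler0n.
- by exists i => //; rewrite eqxx ltr01.
(* The basis vector is positive only at [i], so the witness [j] must be [i]. *)
have [-> [_]|_ []] := eqVneq j i; last by rewrite ltxx.
rewrite (bigD1 i) //= eqxx mulr1 big1 ?addr0 // => l /andP[_ /negPf ->].
by rewrite mulr0.
Qed.

Lemma semimonotone_if_pair (b : bool) (R : realType) (n : nat) (A : 'M[R]_n)
    (i j : 'I_n) :
  i != j -> (forall l, 0 < A l l ?<= if b) -> 0 <= A i j ->
  semimonotone_if b (principal_submx A [set i; j]).
Proof.
move=> neq_ij diagA Aij_ge0; apply/semimonotone_if_principal=> y y_ge0 [l].
rewrite !inE => l_ij yl_gt0.
have diagMy p : 0 < y p -> 0 < A p p * y p ?<= if b.
  move=> yp_gt0; have := diagA p.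
  by case: b {diagA} => /= ?; rewrite ?pmulr_lge0 ?pmulr_lgt0.
have sumE p : \sum_(q in [set i; j]) A p q * y q = A p i * y i + A p j * y j.
  by rewrite big_setU1 ?inE //= big_set1.
(* If [y i] vanishes, row [j] reduces to its diagonal term, whatever the sign of [A j i]. Otherwise
   row [i] is a diagonal term of the right sign plus [A i j * y j >= 0]. *)
have [yi_le0|yi_gt0] := leP (y i) 0.
  have yi0 : y i = 0 by apply/le_anti; rewrite yi_le0 y_ge0.
  have yj_gt0 : 0 < y j.
    by case/orP: l_ij yl_gt0 => /eqP -> //; rewrite yi0 ltxx.
  exists j; first by rewrite !inE eqxx orbT.
  by split=> //; rewrite sumE yi0 mulr0 add0r; exact: diagMy.
exists i; first by rewrite !inE eqxx.
split=> //; rewrite sumE.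
have Ay_ge0 : 0 <= A i j * y j by rewrite mulr_ge0.
have := diagMy i yi_gt0.
by case: b {diagA diagMy} => /= ?; [rewrite addr_ge0 | rewrite ltr_wpDr].
Qed.

Lemma exact_order_diag (b : bool) (R : realType) (n k : nat) (A : 'M[R]_n) :
  (k < n)%N -> of_exact_order (@semimonotone_if b R) k A ->
  forall i, 0 < A i i ?<= if b.
Proof.
move=> ltkn [semiA _] i.
have nk_gt0 : (0 < n - k)%N by rewrite subn_gt0.
(* All indices, with [i] placed first: since [n - k > 0], the first [n - k] of them form a set of
   the required size that contains [i]. *)
pose s := i :: enum (predC1 i).
have size_s : size s = n by rewrite /= -cardE cardC1 card_ord (ltn_predK ltkn).
pose S := [set p in take (n - k) s].
have iS : i \in S by rewrite inE /s -(prednK nk_gt0) mem_head.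
have cardS : #|S| = (n - k)%N.
  rewrite cardsE (card_uniqP _) ?take_uniq //.
    by rewrite size_takel // size_s leq_subr.
  by rewrite /= enum_uniq mem_enum inE /= eqxx.
exact: semimonotone_if_diag (semiA S cardS) iS.
Qed.

Lemma exact_order_offdiag (b : bool) (R : realType) (k : nat)
    (A : 'M[R]_k.+1) :
  (0 < k)%N -> of_exact_order (@semimonotone_if b R) k A ->
  forall i j, i != j -> A i j < 0.
Proof.
move=> k_gt0 exA i j neq_ij; rewrite ltNge; apply/negP => Aij_ge0.
have diagA := exact_order_diag (ltnSn k) exA.
(* The matrix has order [k.+1], so the excluded orders are those above [k.+1 - k = 1]; order 2 is
   one of them because [0 < k]. *)
have [_ /(_ 2) nsemiA] := exA.
apply: (nsemiA _ [set i; j]); last exact: semimonotone_if_pair.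
  by rewrite subSnn ltnS.
by rewrite cards2 neq_ij.
Qed.

Theorem theorem4p6 (R : realType) (n k : nat) (hn : (3 <= n)%N)
    (hk1 : (1 <= k)%N) (hkn : (k < n)%N) (A : 'M[R]_n) :
  ((E0_class k A -> forall i : 'I_n, 0 <= A i i) /\
   (E_class k A -> forall i : 'I_n, 0 < A i i)) /\
  ((E0_class k A -> n = k.+1 ->
      (forall i j : 'I_n, i != j -> A i j < 0) /\ Z_matrix A) /\
   (E_class k A -> n = k.+1 ->
      (forall i j : 'I_n, i != j -> A i j < 0) /\ Z_matrix A)).
Proof.
split; split.
- exact: (@exact_order_diag true).
- exact: (@exact_order_diag false).
- move=> exA eq_nk; subst n.
  have offdiagA := @exact_order_offdiag true _ _ _ hk1 exA.
  by split=> // i j /offdiagA/ltW.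
- move=> exA eq_nk; subst n.
  have offdiagA := @exact_order_offdiag false _ _ _ hk1 exA.
  by split=> // i j /offdiagA/ltW.
Qed.
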